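(* Let $A$ be an automorphism of $\mathbb{P}^2(\mathbb{C})$ whose coefficients are algebraically independent over $\mathbb{Q}$. Then $\mathrm{Ind}^-(A\sigma)=\bigcup_{n\ge1}\mathrm{Ind}\,(A\sigma)^{-n}$ is Zariski dense in $\mathbb{P}^2(\mathbb{C})$.
   Context: $\sigma=(x_1x_2:x_0x_2:x_0x_1)$ is the standard Cremona involution of $\mathbb{P}^2(\mathbb{C})$. An automorphism of $\mathbb{P}^2(\mathbb{C})$, i.e. an element of $\mathrm{PGL}_3(\mathbb{C})$, has coefficients algebraically independent over $\mathbb{Q}$ if it has a representative in $\mathrm{GL}_3(\mathbb{C})$ whose nine entries are algebraically independent over $\mathbb{Q}$. For a birational map $f=(f_0:f_1:f_2)$ of $\mathbb{P}^2(\mathbb{C})$, with the $f_i$ homogeneous of the same degree without common factor, $\mathrm{Ind}\,f$ is the finite set of common zeros of the $f_i$ (the indeterminacy points). *)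

(* Defs.v *)
(* The statement takes R[i], for R : realType, as the field of complex numbers. *)
From mathcomp Require Import all_boot all_order all_algebra.
From mathcomp Require Export classical_sets reals complex mpoly.
Set Implicit Arguments.
Unset Strict Implicit.
Unset Printing Implicit Defensive.
Import GRing.Theory.
Local Open Scope ring_scope.
Local Open Scope classical_set_scope.

Section ProjectivePlane.
Variable K : fieldType.
Implicit Types (p : {mpoly K[3]}) (f g : 3.-tuple {mpoly K[3]}).

(* The points are the lines through the origin of K^3. *)
Definition P2 : Type := {V : {vspace 'cV[K]_3} | \dim V == 1%N}.

Definition homogeneous p : Prop := exists d : nat, p \is d.-homog.

(* Only used for homogeneous p, for which vanishing on the line x amounts to
   vanishing at any one of its nonzero vectors. *)
Definition vanishes_at p (x : P2) : Prop :=
  forall v : 'cV[K]_3, v \in sval x -> p.@[fun i => v i ord0] = 0.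

Definition zariski_closed (Z : set P2) : Prop :=
  exists2 S : set {mpoly K[3]},
    (forall p, S p -> homogeneous p) &
    Z = [set x | forall p, S p -> vanishes_at p x].

Definition zariski_closure (X : set P2) : set P2 :=
  \bigcap_(Z in [set Z | zariski_closed Z /\ X `<=` Z]) Z.

Definition zariski_dense (X : set P2) : Prop := zariski_closure X = setT.

(* A rational map (f_0 : f_1 : f_2) is given by a nonzero triple of forms of the
   same degree, common factors being allowed; two triples give the same map when
   they are proportional over the field of fractions. *)
Definition rational_map f : Prop :=
  (exists d : nat, forall i, tnth f i \is d.-homog) /\
  (exists i, tnth f i != 0).

Definition rat_eq f g : Prop :=
  [/\ rational_map f, rational_map g &
      forall i j, tnth f i * tnth g j = tnth f j * tnth g i].

Definition without_common_factor f : Prop :=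
  forall h : {mpoly K[3]},
    (forall i, exists q, tnth f i = h * q) -> h \is a GRing.unit.

Definition Ind f : set P2 :=
  [set x | exists g, [/\ rat_eq f g, without_common_factor g &
                         forall i, vanishes_at (tnth g i) x]].

Definition rat_id : 3.-tuple {mpoly K[3]} := [tuple 'X_i | i < 3].

(* g after f *)
Definition rat_comp g f : 3.-tuple {mpoly K[3]} :=
  [tuple tnth g i \mPo f | i < 3].

Definition rat_pow f (n : nat) : 3.-tuple {mpoly K[3]} :=
  iter n (rat_comp f) rat_id.

Definition rat_inverse f g : Prop :=
  [/\ rational_map f, rational_map g,
      rat_eq (rat_comp g f) rat_id & rat_eq (rat_comp f g) rat_id].

(* The union over n >= 1 of Ind f^{-n}; f^{-n} is any triple g representing the
   inverse of f^n, since Ind g only depends on the rational map. *)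
Definition Ind_minus f : set P2 :=
  \bigcup_(n in [set n | (1 <= n)%N])
    \bigcup_(g in [set g | rat_inverse (rat_pow f n) g]) Ind g.

Definition linear_map (A : 'M[K]_3) : 3.-tuple {mpoly K[3]} :=
  [tuple \sum_(j < 3) A i j *: 'X_j | i < 3].

Definition cremona : 3.-tuple {mpoly K[3]} :=
  let x (k : nat) : {mpoly K[3]} := 'X_(inord k) in
  [tuple x 1%N * x 2%N; x 0%N * x 2%N; x 0%N * x 1%N].

End ProjectivePlane.

Arguments cremona {K}.

Definition alg_independent (K : fieldType) (n : nat) (a : 'I_n -> K) : Prop :=
  forall P : {mpoly rat[n]}, mmap ratr a P = 0 -> P = 0.

(* The class of A in PGL_3 has a representative with independent entries. *)
Definition alg_independent_coeffs (K : fieldType) (A : 'M[K]_3) : Prop :=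
  exists2 c : K, c != 0 & alg_independent (fun k => mxvec (c *: A) ord0 k).

(* Main.v *)
(* Write f = A sigma.  It contracts the line x_0 = 0 to A e_0, so every triple
   representing the inverse of f^(n+1) vanishes at P_n = f^n (A e_0): the orbit of
   A e_0 consists of indeterminacy points of the f^(-n).  If a nonzero form of
   degree d vanished on the whole orbit, then all maximal minors of the matrix of
   degree d monomials at the points P_n would vanish; they are polynomials over Q
   in the entries of A, so by algebraic independence they would vanish for every
   A.  This fails for a rational A for which, in suitable affine coordinates,
   P_n = (1 / x, 1 / (2^x - 1)) with x = n + 1: no nonzero polynomial in x and 2^x
   is zero for all x >= 1. *)
Require Import Defs.
From mathcomp Require Import all_boot all_order all_algebra.
From mathcomp Require Import classical_sets reals complex mpoly.
From mathcomp Require Import boolp ring zify.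
Set Implicit Arguments.
Unset Strict Implicit.
Unset Printing Implicit Defensive.
Import Order.TTheory GRing.Theory Num.Theory.
Local Open Scope ring_scope.
Local Open Scope complex_scope.

(** * Exponential polynomials *)

Section ExponentialPolynomials.
Variable F : numFieldType.

Lemma poly_nat_roots_eq0 (p : {poly F}) :
  (forall n, (0 < n)%N -> p.[n%:R] = 0) -> p = 0.
Proof.
move=> p_roots; apply/eqP; apply: contraT => p_neq0.
pose rs := [seq (n%:R : F) | n <- iota 1 (size p)].
have: (size rs < size p)%N.
  apply: max_poly_roots => //.
    by apply/allP => _ /mapP[n + ->]; rewrite mem_iota => /andP[n_gt0 _]; apply/rootP/p_roots.
  by rewrite map_inj_uniq ?iota_uniq // => m n /eqP; rewrite eqr_nat => /eqP.
by rewrite size_map size_iota ltnn.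
Qed.

Lemma lead_coef_shift (p : {poly F}) : lead_coef (p \Po ('X + 1%:P)) = lead_coef p.
Proof. by rewrite lead_coef_comp ?size_XaddC // lead_coefXaddC expr1n mulr1. Qed.

(** The shift keeps the size and the leading coefficient, so the leading terms cancel; this drives
    the descent on degree in [exp_poly_eq0]. *)
Lemma size_shift_sub (p : {poly F}) :
  p != 0 -> (size (p \Po ('X + 1%:P) - p)%R < size p)%N.
Proof.
move=> p_neq0; have size_shift : size (p \Po ('X + 1%:P)) = size p.
  by rewrite size_comp_poly2 ?size_XaddC.
rewrite (polySpred p_neq0) ltnS; apply/leq_sizeP => j.
rewrite leq_eqVlt => /orP[/eqP <-|]; last first.
  rewrite -polySpred // => le_pj.
  by rewrite coefB !nth_default ?subrr // ?size_shift.
by rewrite coefB -[in X in X - _]size_shift -!lead_coefE lead_coef_shift subrr.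
Qed.

(* The operator sending [g] to [b ^ j * g_j (X + 1) - b ^ s * g_j] preserves the
   hypothesis and lowers the degree of the top coefficient [g_s]. *)
Lemma exp_poly_eq0 (b : F) (s : nat) (g : nat -> {poly F}) : 1 < b ->
  (forall n, (0 < n)%N -> \sum_(j < s) (g j).[n%:R] * b ^+ n ^+ j = 0) ->
  forall j, (j < s)%N -> g j = 0.
Proof.
move=> b_gt1; have b_neq0 : b != 0 by rewrite gt_eqF // (lt_trans ltr01).
elim: s g => // s IHs g.
have [m] := ubnP (size (g s)); elim: m g => // m IHm g size_g g_eq0.
have [gs_eq0|gs_neq0] := eqVneq (g s) 0.
  move=> j; rewrite ltnS leq_eqVlt => /orP[/eqP-> //|].
  apply: IHs => n /g_eq0; rewrite big_ord_recr /= gs_eq0 horner0 mul0r addr0.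
  by [].
pose g' j := b ^+ j *: (g j \Po ('X + 1%:P)) - b ^+ s *: g j.
have g'_eq0 j : (j < s.+1)%N -> g' j = 0.
  apply: IHm => [|n n_gt0].
    rewrite /g' -scalerBr size_scale ?expf_neq0 //.
    by rewrite (leq_trans (size_shift_sub gs_neq0)).
  transitivity ((\sum_(j < s.+1) (g j).[n.+1%:R] * b ^+ n.+1 ^+ j) -
      b ^+ s * \sum_(j < s.+1) (g j).[n%:R] * b ^+ n ^+ j).
    rewrite mulr_sumr -sumrB; apply: eq_bigr => i _.
    rewrite /g' !hornerE horner_comp !hornerE /= -natr1 exprS exprMn.
    by ring.
  by rewrite !g_eq0 // mulr0 subr0.
(* Leading coefficients in [g' j = 0] give [b ^+ j = b ^+ s] unless [g j = 0], and [1 < b] excludes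
   that equality. *)
have lower j : (j < s)%N -> g j = 0.
  move=> lt_js; have /eqP := congr1 lead_coef (subr0_eq (g'_eq0 j (ltnW lt_js))).
  rewrite !lead_coefZ lead_coef_shift -subr_eq0 -mulrBl mulf_eq0 lead_coef_eq0.
  by rewrite subr_eq0 lt_eqF ?ltr_eXn2l //= => /eqP.
suff gs_eq0 : g s = 0 by rewrite gs_eq0 eqxx in gs_neq0.
apply: poly_nat_roots_eq0 => n n_gt0; have /eqP := g_eq0 n n_gt0.
rewrite big_ord_recr big1 => [|i _] /=; last by rewrite lower // horner0 mul0r.
by rewrite add0r mulf_eq0 !expf_eq0 (negbTE b_neq0) !andbF orbF => /eqP.
Qed.

Lemma biv_exp_poly_eq0 (b : F) (p : {poly {poly F}}) : 1 < b ->
  (forall n, (0 < n)%N -> p.[(b ^+ n)%:P].[n%:R] = 0) -> p = 0.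
Proof.
move=> b_gt1 p_eq0; apply/polyP => j; rewrite coef0.
have [lt_jp|] := ltnP j (size p); last exact: nth_default.
apply: (exp_poly_eq0 (g := fun j => p`_j) b_gt1) lt_jp => n /p_eq0.
rewrite (horner_coef p) horner_sum => p_n; rewrite -[RHS]p_n; apply: eq_bigr => i _.
by rewrite hornerM -polyC_exp hornerC.
Qed.

End ExponentialPolynomials.

(** * Homogeneous polynomials *)

Section CompositionMpoly.
Variable K : comNzRingType.

Lemma comp_mpolyA n k l (p : {mpoly K[n]}) (f : n.-tuple {mpoly K[k]})
    (g : k.-tuple {mpoly K[l]}) :
  (p \mPo f) \mPo g = p \mPo [tuple tnth f i \mPo g | i < n].
Proof.
rewrite !(comp_mpolyEX p) raddf_sum /=; apply: eq_bigr => m _.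
rewrite comp_mpolyZ !comp_mpolyX rmorph_prod; congr (_ *: _).
by apply: eq_bigr => i _; rewrite rmorphXn /= tnth_mktuple.
Qed.

Lemma dhomog_comp n k d e (p : {mpoly K[n]}) (f : n.-tuple {mpoly K[k]}) :
  p \is d.-homog -> (forall i, tnth f i \is e.-homog) ->
  p \mPo f \is (e * d).-homog.
Proof.
move=> /dhomogP p_homog f_homog; rewrite comp_mpolyEX big_seq.
apply: rpred_sum => m /p_homog deg_m; apply: rpredZ.
rewrite comp_mpolyX -[d]deg_m /= mdegE big_distrr /=.
elim/big_rec2: _ => [|i a q _ IH]; first exact: dhomog1.
by apply: dhomogM => //; apply: dhomogMn.
Qed.

Lemma mmap_dhomogZ n (S : comNzRingType) (f : {rmorphism K -> S}) d
    (p : {mpoly K[n]}) (c : S) (h : 'I_n -> S) : p \is d.-homog ->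
  mmap f (fun i => c * h i) p = c ^+ d * mmap f h p.
Proof.
move=> /dhomogP p_homog; rewrite /mmap mulr_sumr; apply: eq_big_seq => m /p_homog deg_m.
rewrite mulrCA; congr (_ * _); rewrite /mmap1 -[d]deg_m /= mdegE -prodrXr -big_split /=.
by apply: eq_bigr => i _; rewrite exprMn.
Qed.

End CompositionMpoly.

Lemma mmap_eq n (K S : nzRingType) (f : K -> S) (h h' : 'I_n -> S) (p : {mpoly K[n]}) :
  h =1 h' -> mmap f h p = mmap f h' p.
Proof. by move=> eq_h; apply: eq_bigr => m _; rewrite (mmap1_eq _ eq_h). Qed.

Section HomogeneousFactors.
Variable K : fieldType.

(** When the exponent is positive, 0 is a root of one of the two factors, so one ['X] cancels from
    that factor and from the right-hand side. *)
Lemma monomial_factors (D : idomainType) (p q : {poly D}) (c : D) d :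
  c != 0 -> p * q = c *: 'X^d -> exists a b, p = b *: 'X^a.
Proof.
have X_neq0 : 'X != 0 :> {poly D} by rewrite polyX_eq0.
move=> c_neq0; elim: d p q => [|d IHd] p q eq_pq.
  exists 0%N, p`_0; rewrite expr0 alg_polyC; apply: size1_polyC.
  have := congr1 (size \o val) eq_pq; rewrite /= expr0 alg_polyC size_polyC c_neq0.
  by move/eqP; rewrite size_mul_eq1 => /andP[/eqP-> _].
have /eqP : (p * q).[0] = 0 by rewrite eq_pq hornerZ hornerXn expr0n mulr0.
rewrite hornerM mulf_eq0 => /orP[] /factor_theorem[r]; rewrite polyC0 subr0 => def.
  have [|a [b def_r]] := IHd r q.
    by apply: (mulIf X_neq0); rewrite mulrAC -def eq_pq exprSr scalerAl.
  by exists a.+1, b; rewrite def def_r exprSr -scalerAl.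
apply: (IHd p r).
by apply: (mulIf X_neq0); rewrite -mulrA -def eq_pq exprSr scalerAl.
Qed.

(** This is p(T x_1, ..., T x_n) as a polynomial in T: its coefficient at T^e is the component of
    degree e of p. *)
Definition grading n (p : {mpoly K[n]}) : {poly {mpoly K[n]}} :=
  mmap (polyC \o @mpolyC n K) (fun i => 'X * ('X_i)%:P) p.

Lemma grading_dhomog n d (p : {mpoly K[n]}) :
  p \is d.-homog -> grading p = p *: 'X^d.
Proof.
move=> p_homog; rewrite /grading (mmap_dhomogZ _ _ _ p_homog) mulrC -mul_polyC.
congr (_ * _); rewrite {2}[p]mpolyE rmorph_sum; apply: eq_bigr => m _ /=.
rewrite -mul_mpolyC rmorphM mpolyXE_id /= /mmap1 rmorph_prod; congr (_ * _).
by apply: eq_bigr => i _; rewrite rmorphXn.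
Qed.

Lemma coef_grading n e (p : {mpoly K[n]}) m :
  (grading p)`_e@_m = p@_m *+ (mdeg m == e).
Proof.
rewrite [in LHS](mpolyE p) /grading rmorph_sum /= coef_sum {3}(mpolyE p) !raddf_sum /=.
rewrite -sumrMnl; apply: eq_bigr => m' _.
rewrite -/(grading _) (@grading_dhomog _ (mdeg m')); last first.
  by rewrite rpredZ // dhomogX.
rewrite coefZ coefXn eq_sym; case: (eqVneq m' m) => [->|ne_m'm].
  by case: eqP => _; rewrite ?mulr1 // mulr0 mcoeff0.
rewrite mcoeffZ mcoeffX (negbTE ne_m'm) mulr0 mul0rn.
by case: eqP => _; rewrite ?mulr0 ?mcoeff0 // mulr1 mcoeffZ mcoeffX (negbTE ne_m'm) mulr0.
Qed.

(** [grading] is multiplicative and sends a form to a monomial in T; factors of such a monomial are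
    monomials in T, whose exponent is the degree sought. *)
Lemma dhomog_factor n d (p q : {mpoly K[n]}) :
  p * q != 0 -> p * q \is d.-homog -> exists e, p \is e.-homog.
Proof.
move=> pq_neq0 /grading_dhomog; rewrite /grading rmorphM.
move=> /(monomial_factors pq_neq0)[a [b]]; rewrite -/(grading p) => def_p.
exists a; apply/dhomogP => m; rewrite mcoeff_msupp.
have := coef_grading (mdeg m) p m; rewrite eqxx mulr1n => <-.
by rewrite (def_p : grading p = _) coefZ coefXn; have [//|_] := eqVneq (mdeg m) a; rewrite mulr0 mcoeff0 eqxx.
Qed.

End HomogeneousFactors.

(** * Rational maps of the plane and reduced inverses *)

Lemma mpolyX_neq0 (K : nzRingType) n (m : 'X_{1..n}) : 'X_[m] != 0 :> {mpoly K[n]}.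
Proof. by rewrite -msupp_eq0 msuppX. Qed.

Section RationalMaps.
Variable K : fieldType.
Implicit Types (p c h : {mpoly K[3]}) (f g : 3.-tuple {mpoly K[3]}).

Definition forms d f := forall i, tnth f i \is d.-homog.

Definition scale_map c f : 3.-tuple {mpoly K[3]} := [tuple c * tnth f i | i < 3].

Lemma tnth_rat_comp f g i : tnth (rat_comp g f) i = tnth g i \mPo f.
Proof. exact: tnth_mktuple. Qed.

Lemma tnth_rat_id i : tnth (rat_id K) i = 'X_i.
Proof. exact: tnth_mktuple. Qed.

Lemma tnth_scale c f i : tnth (scale_map c f) i = c * tnth f i.
Proof. exact: tnth_mktuple. Qed.

Lemma tnth_scale_neq0 c f i : (tnth (scale_map c f) i != 0) = (c != 0) && (tnth f i != 0).
Proof. by rewrite tnth_scale mulf_eq0 negb_or. Qed.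

Lemma rat_compA f g g' : rat_comp (rat_comp g' g) f = rat_comp g' (rat_comp g f).
Proof. by apply: eq_from_tnth => i; rewrite !tnth_rat_comp comp_mpolyA. Qed.

Lemma rat_comp_idl f : rat_comp (rat_id K) f = f.
Proof.
by apply: eq_from_tnth => i; rewrite tnth_rat_comp tnth_rat_id comp_mpolyXU -tnth_nth.
Qed.

Lemma rat_comp_idr f : rat_comp f (rat_id K) = f.
Proof. by apply: eq_from_tnth => i; rewrite tnth_rat_comp comp_mpoly_id. Qed.

Lemma rat_powSr f n : rat_pow f n.+1 = rat_comp (rat_pow f n) f.
Proof.
elim: n => [|n IHn]; first by rewrite /rat_pow /= rat_comp_idl rat_comp_idr.
by rewrite -[LHS]/(rat_comp f (rat_pow f n.+1)) {1}IHn -rat_compA.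
Qed.

Lemma comp_mpoly_scale d p c f :
  p \is d.-homog -> p \mPo scale_map c f = c ^+ d * (p \mPo f).
Proof.
move=> p_homog; rewrite /comp_mpoly -(mmap_dhomogZ _ _ _ p_homog).
by apply: mmap_eq => i; rewrite tnth_scale.
Qed.

Lemma rat_comp_scale d c f g :
  forms d g -> rat_comp g (scale_map c f) = scale_map (c ^+ d) (rat_comp g f).
Proof.
move=> g_forms; apply: eq_from_tnth => i.
by rewrite tnth_scale !tnth_rat_comp (comp_mpoly_scale _ _ (g_forms i)).
Qed.

Lemma scale_rat_comp c f g :
  rat_comp (scale_map c g) f = scale_map (c \mPo f) (rat_comp g f).
Proof.
by apply: eq_from_tnth => i; rewrite tnth_scale !tnth_rat_comp tnth_scale rmorphM.
Qed.

Lemma scale_scale c c' f : scale_map c (scale_map c' f) = scale_map (c * c') f.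
Proof. by apply: eq_from_tnth => i; rewrite !tnth_scale mulrA. Qed.

Lemma forms_comp d e f g : forms d f -> forms e g -> forms (d * e) (rat_comp g f).
Proof. by move=> f_forms g_forms i; rewrite tnth_rat_comp; apply: dhomog_comp. Qed.

Lemma forms_id : forms 1 (rat_id K).
Proof. by move=> i; rewrite tnth_rat_id dhomogX /= mdeg1. Qed.

Lemma forms_pow d f n : forms d f -> forms (d ^ n) (rat_pow f n).
Proof.
move=> f_forms; elim: n => [|n IHn]; first exact: forms_id.
by rewrite expnSr; apply: forms_comp.
Qed.

(** Composing once more with [f] turns [p \mPo g] into [c ^+ d * p], a product of nonzero elements
    of a domain. *)
Lemma comp_mpoly_neq0 d p c f g : rat_comp g f = scale_map c (rat_id K) ->
  c != 0 -> p \is d.-homog -> p != 0 -> p \mPo g != 0.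
Proof.
move=> gf c_neq0 p_homog; apply: contra => /eqP pg_eq0.
have /eqP := comp_mpoly_scale c (rat_id K) p_homog.
rewrite -gf -comp_mpolyA pg_eq0 comp_mpoly0 comp_mpoly_id eq_sym.
by apply: contraTT => p_neq0; rewrite mulf_neq0 ?expf_neq0.
Qed.

(** Induction cancels the middle pair of f^n f g g^n. Both compositions are carried along, because
    the new factor c(g^n) is nonzero by the relation for the other composition. *)
Lemma rat_pow_inverse d e k l c c' f g : forms d f -> forms e g ->
  c \is k.-homog -> c' \is l.-homog -> c != 0 -> c' != 0 ->
  rat_comp f g = scale_map c (rat_id K) -> rat_comp g f = scale_map c' (rat_id K) ->
  forall n, exists a b, [/\ a != 0, b != 0,
    rat_comp (rat_pow f n) (rat_pow g n) = scale_map a (rat_id K) &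
    rat_comp (rat_pow g n) (rat_pow f n) = scale_map b (rat_id K)].
Proof.
have step (d1 k1 n : nat) f1 g1 c1 a b : forms d1 f1 -> c1 \is k1.-homog -> c1 != 0 ->
    a != 0 -> b != 0 -> rat_comp f1 g1 = scale_map c1 (rat_id K) ->
    rat_comp (rat_pow f1 n) (rat_pow g1 n) = scale_map a (rat_id K) ->
    rat_comp (rat_pow g1 n) (rat_pow f1 n) = scale_map b (rat_id K) ->
    exists2 a', a' != 0 &
      rat_comp (rat_pow f1 n.+1) (rat_pow g1 n.+1) = scale_map a' (rat_id K).
  move=> f_forms c_homog c_neq0 a_neq0 b_neq0 fg fgn gfn.
  (* The factor left by the middle pair is pulled through [rat_pow f1 n], whose forms have degree
     [d1 ^ n]. *)
  exists ((c1 \mPo rat_pow g1 n) ^+ (d1 ^ n) * a).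
    by rewrite mulf_neq0 // expf_neq0 // (comp_mpoly_neq0 gfn b_neq0 c_homog).
  rewrite rat_powSr rat_compA -[rat_pow g1 n.+1]/(rat_comp g1 (rat_pow g1 n)).
  rewrite -[rat_comp f1 _]rat_compA fg scale_rat_comp rat_comp_idl.
  by rewrite (rat_comp_scale _ _ (forms_pow n f_forms)) fgn scale_scale.
move=> f_forms g_forms c_homog c'_homog c_neq0 c'_neq0 fg gf.
elim=> [|n [a [b [a_neq0 b_neq0 fgn gfn]]]].
  exists 1, 1; rewrite oner_neq0 /rat_pow /= rat_comp_idl; split=> //;
  by apply: eq_from_tnth => i; rewrite tnth_scale mul1r.
have [a' a'_neq0 fgS] := step _ _ _ _ _ _ _ _ f_forms c_homog c_neq0 a_neq0 b_neq0 fg fgn gfn.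
have [b' b'_neq0 gfS] := step _ _ _ _ _ _ _ _ g_forms c'_homog c'_neq0 b_neq0 a_neq0 gf gfn fgn.
by exists a', b'.
Qed.

Lemma rational_map_forms d f i : forms d f -> tnth f i != 0 -> rational_map f.
Proof. by move=> f_forms fi; split; [exists d | exists i]. Qed.

Lemma rational_map_id : rational_map (rat_id K).
Proof. by apply: (rational_map_forms (i := ord0) forms_id); rewrite tnth_rat_id mpolyX_neq0. Qed.

Lemma comp_rational_map d e c f g : forms d f -> forms e g -> c != 0 ->
  rat_comp g f = scale_map c (rat_id K) ->
  rational_map g /\ Defs.rat_eq (rat_comp g f) (rat_id K).
Proof.
move=> f_forms g_forms c_neq0 gf.
have gf0 : tnth (rat_comp g f) ord0 != 0.
  by rewrite gf tnth_scale_neq0 c_neq0 tnth_rat_id mpolyX_neq0.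
split.
  apply: (rational_map_forms (i := ord0) g_forms); apply: contraNneq gf0 => g0.
  by rewrite tnth_rat_comp g0 comp_mpoly0.
split; [exact: (rational_map_forms (forms_comp f_forms g_forms) gf0) | exact: rational_map_id |].
by move=> i j; rewrite gf !tnth_scale !tnth_rat_id -!mulrA ['X_j * _]mulrC.
Qed.

Lemma rat_inverse_scale d e c c' f g : forms d f -> forms e g -> c != 0 -> c' != 0 ->
  rat_comp f g = scale_map c (rat_id K) -> rat_comp g f = scale_map c' (rat_id K) ->
  rat_inverse f g.
Proof.
move=> f_forms g_forms c_neq0 c'_neq0 fg gf.
have [? ?] := comp_rational_map g_forms f_forms c_neq0 fg.
by have [? ?] := comp_rational_map f_forms g_forms c'_neq0 gf.
Qed.

Lemma rat_eq_scalel d c f g : forms d f -> Defs.rat_eq (scale_map c f) g -> Defs.rat_eq f g.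
Proof.
move=> f_forms [[_ [i cfi]] g_rat fg].
have [c_neq0 fi] : c != 0 /\ tnth f i != 0 by apply/andP; rewrite -tnth_scale_neq0.
split=> [||j k] //; first exact: rational_map_forms f_forms fi.
by apply: (mulfI c_neq0); have := fg j k; rewrite !tnth_scale !mulrA.
Qed.

Lemma rat_inverse_unscale d c f g : forms d g -> rat_inverse f (scale_map c g) ->
  rat_inverse f g.
Proof.
move=> g_forms [f_rat [_ [i cgi]] gf fg].
have gi : tnth g i != 0 by move: cgi; rewrite tnth_scale_neq0 => /andP[].
have [[e f_forms] _] := f_rat; split; first exact: f_rat.
- exact: rational_map_forms g_forms gi.
- by apply: (rat_eq_scalel (c := c \mPo f) (forms_comp f_forms g_forms)); rewrite -scale_rat_comp; exact: gf.
- apply: (rat_eq_scalel (c := c ^+ e) (forms_comp g_forms f_forms)).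
  by rewrite -(rat_comp_scale _ _ f_forms); exact: fg.
Qed.

Lemma dhomog0_unit h : h != 0 -> h \is 0.-homog -> h \is a GRing.unit.
Proof.
move=> h_neq0 h_homog; have def_h : h = (h@_0%MM)%:MP.
  apply/mpolyP => m; rewrite mcoeffC; have [->|m_neq0] := eqVneq m 0%MM.
    by rewrite mulr1.
  by rewrite mulr0 (dhomog_nemf_coeff h_homog) //= mdeg_eq0.
have h0 : h@_0%MM != 0 by apply: contraNneq h_neq0 => h0; rewrite def_h h0 mpolyC0.
by apply/unitrPr; exists (h@_0%MM)^-1%:MP; rewrite {1}def_h -mpolyCM mulfV // mpolyC1.
Qed.

(** Descent on the degree of [g]: a common factor that is not a unit is homogeneous of positive
    degree, and dividing by it leaves an inverse of smaller degree. *)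
Lemma reduced_inverse f g : rat_inverse f g ->
  exists2 g', rat_inverse f g' & without_common_factor g'.
Proof.
move=> fg; have [_ [[d g_forms] _] _ _] := fg.
have [m] := ubnP d; elim: m d g g_forms fg => // m IHm d g g_forms fg le_dm.
have [|] := pselect (without_common_factor g); first by exists g.
move=> /existsNP[h /not_implyP[/choice[q def_g] h_nunit]].
pose t : 3.-tuple {mpoly K[3]} := [tuple q i | i < 3].
have def_g' : g = scale_map h t.
  by apply: eq_from_tnth => i; rewrite tnth_scale tnth_mktuple.
have [_ [_ [i gi]] _ _] := fg.
have [e h_homog] : exists e, h \is e.-homog.
  by apply: (@dhomog_factor _ _ d _ (q i)); rewrite -def_g.
have h_neq0 : h != 0 by apply: contraNneq gi => h0; rewrite def_g h0 mul0r.
have e_gt0 : (0 < e)%N.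
  rewrite lt0n; apply/eqP => e0; apply: h_nunit; apply: dhomog0_unit => //.
  by move: h_homog; rewrite e0.
(* Only nonzero quotients determine a degree; a zero quotient is a form of every degree. *)
have q_homog j : q j != 0 -> q j \is (d - e).-homog /\ (e <= d)%N.
  move=> qj; have qh : q j * h = tnth g j by rewrite def_g mulrC.
  have gj : q j * h != 0 by rewrite mulf_neq0.
  have [k qk] : exists k, q j \is k.-homog.
    by apply: (@dhomog_factor _ _ d _ h) => //; rewrite qh.
  have <- : (e + k)%N = d.
    apply: (dhomog_uniq gj); last by rewrite qh.
    by rewrite mulrC; apply: dhomogM.
  by rewrite addKn leq_addr.
have t_forms : forms (d - e) t.
  move=> j; rewrite tnth_mktuple; have [->|] := eqVneq (q j) 0; first exact: dhomog0.
  by case/q_homog.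
apply: (IHm _ t t_forms).
  by apply: (rat_inverse_unscale t_forms (c := h)); rewrite -def_g'.
have [|_ le_ed] := q_homog i.
  by apply: contraNneq gi => qi; rewrite def_g qi mulr0.
by rewrite -ltnS (leq_trans _ le_dm) // ltnS ltn_subrL e_gt0 (leq_trans e_gt0).
Qed.

End RationalMaps.

(** * The standard Cremona involution *)

Section CremonaMaps.
Variable K : fieldType.
Implicit Types (A B : 'M[K]_3) (f : 3.-tuple {mpoly K[3]}).

Definition coord_prod : {mpoly K[3]} := \prod_(i < 3) 'X_i.

Lemma forall_ord3 (P : 'I_3 -> Prop) :
  P ord0 -> P (inord 1) -> P (inord 2) -> forall i, P i.
Proof.
move=> P0 P1 P2 [[|[|[|//]]] lti].
- by have -> : Ordinal lti = ord0 by apply: val_inj.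
- by have -> : Ordinal lti = inord 1 by apply: val_inj; rewrite /= inordK.
- by have -> : Ordinal lti = inord 2 by apply: val_inj; rewrite /= inordK.
Qed.

Lemma big_ord3 (T : Type) (idx : T) (op : Monoid.law idx) (E : 'I_3 -> T) :
  \big[op/idx]_(i < 3) E i = op (E ord0) (op (E (inord 1)) (E (inord 2))).
Proof.
rewrite !big_ord_recl big_ord0 Monoid.mulm1; congr (op (E _) (op (E _) (E _)));
by apply: val_inj; rewrite /= ?inordK.
Qed.

Lemma tnth_cremona :
  [/\ tnth (@cremona K) ord0 = 'X_(inord 1) * 'X_(inord 2),
      tnth (@cremona K) (inord 1) = 'X_ord0 * 'X_(inord 2) &
      tnth (@cremona K) (inord 2) = 'X_ord0 * 'X_(inord 1)].
Proof.
have -> : ord0 = inord 0 :> 'I_3 by apply: val_inj; rewrite /= inordK.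
by split; rewrite (tnth_nth 0) /= ?inordK.
Qed.

Lemma tnth_linear A i : tnth (linear_map A) i = \sum_(j < 3) A i j *: 'X_j.
Proof. exact: tnth_mktuple. Qed.

Lemma forms_linear A : forms 1 (linear_map A).
Proof.
move=> i; rewrite tnth_linear; apply: rpred_sum => j _; apply: rpredZ.
by rewrite dhomogX /= mdeg1.
Qed.

Lemma forms_cremona : forms 2 (@cremona K).
Proof.
have [c0 c1 c2] := tnth_cremona.
by apply: forall_ord3; rewrite (c0, c1, c2) -mpolyXD dhomogX /= mdegD !mdeg1.
Qed.

Lemma rat_comp_linear A B :
  rat_comp (linear_map A) (linear_map B) = linear_map (A *m B).
Proof.
apply: eq_from_tnth => i; rewrite tnth_rat_comp !tnth_linear raddf_sum /=.
under eq_bigr do rewrite comp_mpolyZ comp_mpolyXU -tnth_nth tnth_linear scaler_sumr.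
rewrite exchange_big; apply: eq_bigr => j _ /=.
by rewrite mxE scaler_suml; apply: eq_bigr => k _; rewrite scalerA.
Qed.

Lemma linear_map1 : linear_map 1%:M = rat_id K.
Proof.
apply: eq_from_tnth => i; rewrite tnth_linear tnth_rat_id (bigD1 i) //=.
rewrite mxE eqxx scale1r big1 ?addr0 // => j; rewrite mxE eq_sym => /negbTE->.
by rewrite scale0r.
Qed.

Lemma cremona_involution :
  rat_comp cremona cremona = scale_map coord_prod (rat_id K).
Proof.
have [c0 c1 c2] := tnth_cremona; apply: eq_from_tnth.
apply: forall_ord3; rewrite tnth_rat_comp tnth_scale tnth_rat_id (c0, c1, c2);
  rewrite rmorphM /= !comp_mpolyXU -!tnth_nth !(c0, c1, c2) /coord_prod big_ord3 /=;
  ring.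
Qed.

Lemma coord_prod_homog : coord_prod \is 3.-homog.
Proof.
have X_homog (i : 'I_3) : ('X_i : {mpoly K[3]}) \is 1.-homog by rewrite dhomogX /= mdeg1.
by rewrite /coord_prod big_ord3; apply: (@dhomogM _ _ _ 1 _ 2) => //; apply: (@dhomogM _ _ _ 1 _ 1).
Qed.

Lemma coord_prod_neq0 : coord_prod != 0.
Proof. by apply/prodf_neq0 => i _; apply: mpolyX_neq0. Qed.

(** The inverse of A sigma is sigma A^(-1): the two compositions are the identity up to [coord_prod]
    and [coord_prod] composed with A^(-1). *)
Lemma cremona_pow_inverse A n : A \in unitmx ->
  exists g, rat_inverse (rat_pow (rat_comp (linear_map A) cremona) n) g.
Proof.
move=> A_unit; set f := rat_comp _ _; set B := linear_map (invmx A).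
pose g := rat_comp cremona B; pose s := coord_prod.
have AB : rat_comp (linear_map A) B = rat_id K by rewrite rat_comp_linear mulmxV // linear_map1.
have BA : rat_comp B (linear_map A) = rat_id K by rewrite rat_comp_linear mulVmx // linear_map1.
have BA1 : rat_comp B (linear_map A) = scale_map 1 (rat_id K).
  by rewrite BA; apply: eq_from_tnth => i; rewrite tnth_scale mul1r.
have fg : rat_comp f g = scale_map (s \mPo B) (rat_id K).
  rewrite /f /g rat_compA -[rat_comp cremona (rat_comp _ _)]rat_compA cremona_involution.
  rewrite scale_rat_comp rat_comp_idl (rat_comp_scale _ _ (@forms_linear A)) AB expr1.
  by [].
have gf : rat_comp g f = scale_map s (rat_id K).
  rewrite /f /g rat_compA -[rat_comp B (rat_comp _ _)]rat_compA BA rat_comp_idl.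
  exact: cremona_involution.
have f_forms : forms 2 f by exact: (forms_comp forms_cremona (@forms_linear A)).
have g_forms : forms 2 g by exact: (forms_comp (@forms_linear _) forms_cremona).
have sB_homog : s \mPo B \is 3.-homog.
  by apply: (dhomog_comp coord_prod_homog (@forms_linear _)).
have sB_neq0 := comp_mpoly_neq0 BA1 (oner_neq0 _) coord_prod_homog coord_prod_neq0.
have [a [b [a_neq0 b_neq0 fgn gfn]]] :=
  rat_pow_inverse f_forms g_forms sB_homog coord_prod_homog sB_neq0 coord_prod_neq0 fg gf n.
exists (rat_pow g n).
exact: rat_inverse_scale (forms_pow n f_forms) (forms_pow n g_forms) a_neq0 b_neq0 fgn gfn.
Qed.

End CremonaMaps.

(** * The orbit of the contracted line *)

Section Orbit.
Variable S : comNzRingType.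
Implicit Types (A : 'M[S]_3) (v : 'cV[S]_3).

(** Acting on vectors over any commutative ring, it also applies to the matrix of indeterminates
    [generic_mx]. *)
Definition cremona_cv v : 'cV[S]_3 :=
  let x k := v (inord k) ord0 in
  \col_i [:: x 1%N * x 2%N; x 0%N * x 2%N; x 0%N * x 1%N]`_i.

Definition step A v : 'cV[S]_3 := A *m cremona_cv v.

(* The forward orbit of the point to which [A sigma] contracts [x_0 = 0]. *)
Definition orbit A n : 'cV[S]_3 := iter n (step A) (col ord0 A).

Lemma cremona_cvZ (c : S) v : cremona_cv (c *: v) = c ^+ 2 *: cremona_cv v.
Proof.
by apply/colP; apply: forall_ord3; rewrite !mxE ?inordK //=; ring.
Qed.

Lemma stepZ A (c : S) v : step A (c *: v) = c ^+ 2 *: step A v.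
Proof. by rewrite /step cremona_cvZ -scalemxAr. Qed.

Lemma iter_stepZ A (c : S) v n :
  iter n (step A) (c *: v) = c ^+ (2 ^ n) *: iter n (step A) v.
Proof.
elim: n => [|n IHn]; first by rewrite expr1.
by rewrite !iterS IHn stepZ -exprM -expnSr.
Qed.

(** A step is linear in the matrix and quadratic in the vector. This allows [A] to be replaced by
    its representative with independent entries. *)
Lemma orbit_scale A (c : S) n : exists k, orbit (c *: A) n = c ^+ k *: orbit A n.
Proof.
elim: n => [|n [k IHn]]; first by exists 1%N; rewrite /orbit /= linearZ expr1.
exists (1 + k * 2)%N; rewrite /orbit !iterS -!/(orbit _ n) IHn stepZ.
by rewrite {1}/step -scalemxAl scalerA -exprM mulrC exprD.
Qed.

End Orbit.

Lemma map_orbit (S T : comNzRingType) (phi : {rmorphism S -> T}) (A : 'M[S]_3) n :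
  map_mx phi (orbit A n) = orbit (map_mx phi A) n.
Proof.
elim: n => [|n IHn]; first by rewrite map_col.
rewrite /orbit !iterS -!/(orbit _ n) -IHn /step map_mxM; congr (_ *m _).
by apply/colP; apply: forall_ord3; rewrite !mxE ?inordK //= rmorphM.
Qed.

Section OrbitPoints.
Variable K : numFieldType.
Implicit Types (A : 'M[K]_3) (v w : 'cV[K]_3) (p : {mpoly K[3]}).

Notation ev p v := (p.@[fun i => (v : 'cV_3) i ord0]).

Lemma evZ d p (c : K) v : p \is d.-homog -> ev p (c *: v) = c ^+ d * ev p v.
Proof.
move=> p_homog; rewrite /meval -(mmap_dhomogZ _ _ _ p_homog).
by apply: mmap_eq => i; rewrite mxE.
Qed.

Lemma ev_cremona v i : ev (tnth cremona i) v = cremona_cv v i ord0.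
Proof.
have [c0 c1 c2] := tnth_cremona K.
have ord3_0 : ord0 = inord 0 :> 'I_3 by apply: val_inj; rewrite /= inordK.
move: i; apply: forall_ord3; rewrite (c0, c1, c2) mevalM !mevalXU !mxE ?inordK //=;
  by rewrite -?ord3_0.
Qed.

Lemma ev_step A v i :
  ev (tnth (rat_comp (linear_map A) cremona) i) v = step A v i ord0.
Proof.
rewrite tnth_rat_comp comp_mpoly_meval tnth_linear raddf_sum /= mxE.
by apply: eq_bigr => j _; rewrite mevalZ mevalXU ev_cremona.
Qed.

Lemma ev_pow A n v i :
  ev (tnth (rat_pow (rat_comp (linear_map A) cremona) n) i) v =
  iter n (step A) v i ord0.
Proof.
elim: n i => [|n IHn] i; first by rewrite tnth_rat_id mevalXU.
rewrite iterS -ev_step [rat_pow _ _]/= tnth_rat_comp comp_mpoly_meval.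
by apply: meval_eq => j; apply: IHn.
Qed.

(* Since [A sigma] maps [(0 : 1 : t)] to [A e_0], clearing the factor that makes
   [g] an inverse of [(A sigma)^(n+1)] gives [g (orbit A n) = c (0, 1, t)] for
   both [t = 1] and [t = 2]. *)
Lemma inverse_vanishes A n g :
  rat_inverse (rat_pow (rat_comp (linear_map A) cremona) n.+1) g ->
  forall i, ev (tnth g i) (orbit A n) = 0.
Proof.
set f := rat_comp _ _ => -[_ [[e g_forms] _] [_ _ gf] _].
pose w t : 'cV[K]_3 := \col_i [:: 0; 1; t]`_i.
pose G i := ev (tnth g i) (orbit A n).
(* [w t] is (0, 1, t), which sigma sends to t e_0. Up to a power of [t], the value of g after
   f^(n+1) there is [G], independent of [t]. *)
have GE t j k : t != 0 -> G j * w t k ord0 = G k * w t j ord0.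
  move=> t_neq0; have step_w : step A (w t) = t *: col ord0 A.
    rewrite /step colE scalemxAr; congr (_ *m _); apply/colP.
    by apply: forall_ord3; rewrite !mxE ?inordK //= ?mul0r ?mul1r ?mulr1 ?mulr0 //
      -val_eqE /= inordK // mulr0.
  have ev_gf i : ev (tnth (rat_comp g (rat_pow f n.+1)) i) (w t) =
      t ^+ (2 ^ n * e) * G i.
    rewrite tnth_rat_comp comp_mpoly_meval exprM /G -(evZ _ _ (g_forms i)).
    by apply: meval_eq => l; rewrite ev_pow iterSr step_w iter_stepZ.
  have := congr1 (meval (fun i => w t i ord0)) (gf j k).
  rewrite !mevalM !ev_gf !tnth_rat_id !mevalXU -!mulrA.
  by apply: mulfI; rewrite expf_neq0.
have G0 : G ord0 = 0.
  by have := GE 1 ord0 (inord 1) (oner_neq0 _); rewrite !mxE inordK //= mulr1 mulr0.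
have /eqP G12 : G (inord 1) = G (inord 2).
  by have := GE 1 (inord 1) (inord 2) (oner_neq0 _); rewrite !mxE !inordK //= !mulr1.
(* Here t = 2 gives 2 G_1 = G_2, against G_1 = G_2 from t = 1. *)
have G1 : G (inord 1) = 0.
  have two_neq0 : 2 != 0 :> K by rewrite pnatr_eq0.
  have := GE 2 (inord 1) (inord 2) two_neq0; rewrite !mxE !inordK //= mulr1 -(eqP G12).
  by move/eqP; rewrite -subr_eq0 mulr_natr mulr2n addrK => /eqP.
by apply: forall_ord3; rewrite -/(G _) -?(eqP G12).
Qed.

Lemma dim_line v : v != 0 -> \dim <[v]>%VS == 1%N.
Proof. by rewrite dim_vline => ->. Qed.

Definition point v (v_neq0 : v != 0) : P2 K := exist _ <[v]>%VS (dim_line v_neq0).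

Lemma vanishes_at_point d p v (v_neq0 : v != 0) : p \is d.-homog ->
  vanishes_at p (point v_neq0) <-> ev p v = 0.
Proof.
move=> p_homog; split=> [-> //|pv _ /vlineP[c ->]]; first exact: memv_line.
by rewrite (evZ _ _ p_homog) pv mulr0.
Qed.

(** [Ind] is read off a triple without common factor; [inverse_vanishes] holds for every inverse
    triple, hence for a reduced one. *)
Lemma orbit_Ind_minus A n (orb_neq0 : orbit A n != 0) : A \in unitmx ->
  Ind_minus (rat_comp (linear_map A) cremona) (point orb_neq0).
Proof.
move=> A_unit; exists n.+1 => //.
have [g0 /reduced_inverse[g g_inv g_red]] := cremona_pow_inverse n.+1 A_unit.
exists g; first exact: g_inv.
have [_ g_rat _ _] := g_inv; have [[e g_forms] _] := g_rat.
exists g; split=> [||i]; [by split=> // i j; rewrite mulrC | exact: g_red |].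
by apply/(vanishes_at_point _ (g_forms i)); apply: inverse_vanishes g_inv i.
Qed.

End OrbitPoints.

(** * A rational matrix with dense orbit *)

(** No nonzero linear form kills all the rows, so finitely many of them span; the rank of initial
    segments is raised one unit at a time. *)
Lemma interpolation_nodes (F : fieldType) k (w : nat -> 'rV[F]_k) :
  (forall c : 'cV[F]_k, (forall n, w n *m c = 0) -> c = 0) ->
  exists f : 'I_k -> nat, \matrix_i w (f i) \in unitmx.
Proof.
move=> w_total; pose W N : 'M[F]_(N, k) := \matrix_(i < N) w i.
have rowW N n : (n < N)%N -> (w n <= W N)%MS.
  move=> lt_nN; have -> : w n = row (Ordinal lt_nN) (W N) by rewrite rowK.
  exact: row_sub.
have rank_W r : (r <= k)%N -> exists N, (r <= \rank (W N))%N.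
  elim: r => [|r IHr] lt_rk; first by exists 0%N.
  have [N le_r] := IHr (ltnW lt_rk).
  have [lt_r|] := ltnP r (\rank (W N)); first by exists N.
  (* Otherwise every column of the cokernel kills all [w n], hence is zero, and [W N] already has
     rank [k]. *)
  move=> ge_r; have [n w_n] : exists n, w n *m cokermx (W N) != 0.
    apply: contrapT => /forallNP w_coker; have : \rank (cokermx (W N)) = 0%N.
      apply/eqP; rewrite mxrank_eq0; apply/eqP/matrixP => i j.
      have /colP/(_ i) : col j (cokermx (W N)) = 0.
        apply: w_total => n; rewrite colE mulmxA.
        by have /negP := w_coker n; rewrite negbK => /eqP->; rewrite mul0mx.
      by rewrite !mxE.
    rewrite mxrank_coker => /eqP; rewrite subn_eq0 leqNgt.
    by rewrite (leq_ltn_trans ge_r).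
  exists (maxn N n.+1); apply: (leq_ltn_trans le_r); rewrite ltnNge.
  have sub_W : (W N <= W (maxn N n.+1))%MS.
    by apply/row_subP => i; rewrite rowK rowW // leq_max ltn_ord.
  apply/negP => le_rank; have /eqmxP eq_W : (W N == W (maxn N n.+1))%MS.
    by rewrite -(geq_leqif (mxrank_leqif_eq sub_W)).
  by move: w_n; rewrite -submxE eq_W rowW ?leq_max ?ltnSn ?orbT.
have [N full_W] := rank_W k (leqnn k).
have {}full_W : row_full (W N) by rewrite /row_full eqn_leq rank_leq_col.
exists (fun i => fullrankfun full_W i).
have -> : \matrix_i w (fullrankfun full_W i) = rowsub (fullrankfun full_W) (W N).
  by apply/matrixP => i j; rewrite !mxE.
exact: fullrowsub_unit.
Qed.

Section DenseRationalOrbit.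

Notation ev p v := (p.@[fun i => v i ord0]).

Definition mx3 (R : nzRingType) (s : seq (seq R)) : 'M[R]_3 := \matrix_(i, j) (nth [::] s i)`_j.

(* In the affine coordinates [u = x_1 / x_0] and [v = x_2 / x_0] this matrix
   makes [A sigma] the product of the Moebius maps [2 - 1 / u] and [3 - 2 / v],
   which are parabolic and of multiplier [2] respectively. *)
Definition A0 : 'M[rat]_3 := mx3 [:: [:: 1; 0; 0]; [:: 2; -1; 0]; [:: 3; 0; -2]].

(** Denominators cleared in u = 1 + 1 / x and v = 2 + 1 / (N - 1), where 1 and 2 are fixed points of
    the two Moebius maps. *)
Definition orbit_point (x N : rat) : 'cV[rat]_3 :=
  \col_i [:: x * (N - 1); (x + 1) * (N - 1); x * (2 * N - 1)]`_i.

Lemma step_orbit_point x N :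
  step A0 (orbit_point x N) = (x * (N - 1)) *: orbit_point (x + 1) (2 * N).
Proof.
apply/colP; apply: forall_ord3; rewrite !mxE big_ord3 !mxE !inordK //=; ring.
Qed.

Lemma orbit_A0 n : exists2 c, c != 0 & orbit A0 n = c *: orbit_point n.+1%:R (2 ^+ n.+1).
Proof.
elim: n => [|n [c c_neq0 IHn]].
  exists 1; rewrite ?oner_neq0 // scale1r; apply/colP.
  by apply: forall_ord3; rewrite !mxE ?inordK.
(* The old factor is squared by [stepZ]; the rest comes from [step_orbit_point]. *)
exists (c ^+ 2 * (n.+1%:R * (2 ^+ n.+1 - 1))).
  rewrite !mulf_neq0 ?expf_neq0 ?pnatr_eq0 // subr_eq0.
  by rewrite gt_eqF // exprn_egt1.
rewrite /orbit iterS -/(orbit _ n) IHn stepZ step_orbit_point scalerA.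
by rewrite natr1 -exprS.
Qed.

Lemma dense_orbit_A0 d (q : {mpoly rat[3]}) : q \is d.-homog ->
  (forall n, ev q (orbit A0 n) = 0) -> q = 0.
Proof.
move=> q_homog q_orbit; apply/eqP; apply: contraT => q_neq0.
(* [linear_map M] sends [(x (N - 1), N - 1, x)] to [orbit_point x N]; on such
   triples distinct monomials of degree [d] give distinct monomials in [x] and [N - 1]. *)
pose M : 'M[rat]_3 := mx3 [:: [:: 1; 0; 0]; [:: 1; 1; 0]; [:: 2; 0; 1]].
pose M' : 'M[rat]_3 := mx3 [:: [:: 1; 0; 0]; [:: -1; 1; 0]; [:: -2; 0; 1]].
have MM' : rat_comp (linear_map M) (linear_map M') = scale_map 1 (rat_id _).
  have -> : scale_map 1 (rat_id _) = rat_id rat.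
    by apply: eq_from_tnth => i; rewrite tnth_scale mul1r.
  rewrite rat_comp_linear -linear_map1; congr linear_map; apply/matrixP.
  apply: forall_ord3; apply: forall_ord3; rewrite !mxE big_ord3 !mxE -?val_eqE /= !inordK //=; ring.
pose r := q \mPo linear_map M.
have r_neq0 : r != 0 := comp_mpoly_neq0 MM' (oner_neq0 _) q_homog q_neq0.
have /dhomogP r_homog : r \is (1 * d).-homog.
  by apply: (dhomog_comp q_homog); apply: forms_linear.
(* At (x (N - 1), N - 1, x) the monomial [m] becomes x^a (N - 1)^b; in [H] the inner variable stands
   for x, the outer one for N - 1. *)
pose a (m : 'X_{1..3}) := (m ord0 + m (inord 2))%N.
pose b (m : 'X_{1..3}) := (m ord0 + m (inord 1))%N.
pose H : {poly {poly rat}} := \sum_(m <- msupp r) (r@_m *: 'X^(a m)) *: 'X^(b m).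
have H_orbit n : (0 < n)%N -> H.[(2 ^+ n - 1)%:P].[n%:R] = 0.
  case: n => // n _; have [c c_neq0 orb_n] := orbit_A0 n.
  have /eqP := q_orbit n; rewrite orb_n (evZ _ _ q_homog) mulf_eq0 expf_eq0.
  rewrite (negbTE c_neq0) andbF /= => /eqP <-.
  set x := n.+1%:R; set N := 2 ^+ n.+1.
  pose v : 'cV[rat]_3 := \col_i [:: x * (N - 1); N - 1; x]`_i.
  transitivity (ev r v); last first.
    rewrite comp_mpoly_meval; apply: meval_eq => i.
    rewrite tnth_linear raddf_sum /=; under eq_bigr do rewrite mevalZ mevalXU.
    move: i; apply: forall_ord3; rewrite big_ord3 !mxE !inordK //=; ring.
  rewrite mevalE !horner_sum; apply: eq_bigr => m _.
  rewrite !hornerE big_ord3 !mxE !inordK //= exprMn !exprD; ring.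
have H_eq0 : H = 0.
  (* Substituting ['X - 1] for the outer variable replaces the evaluation points 2^n - 1 by 2^n. *)
  apply/eqP; rewrite -(comp_poly2_eq0 H (size_XsubC 1)); apply/eqP.
  apply: (biv_exp_poly_eq0 (b := 2)) => // n n_gt0.
  by rewrite horner_comp !hornerE -(H_orbit n n_gt0) polyCB.
have := mlead_supp r_neq0; set m0 := mlead r => m0_r.
have : H`_(b m0)`_(a m0) = r@_m0.
  rewrite !coef_sum (bigD1_seq m0) ?msupp_uniq //= big_seq_cond big1.
    by rewrite addr0 coefZ coefXn eqxx mulr1 coefZ coefXn eqxx mulr1.
  move=> m /andP[m_r ne_m]; rewrite coefZ coefXn.
  have [eq_b|] := eqVneq (b m0) (b m); last by rewrite mulr0 coef0.
  rewrite mulr1 coefZ coefXn; have [eq_a|] := eqVneq (a m0) (a m); last by rewrite mulr0.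
  (* With m_0 + m_1 + m_2 = d, the exponents are recovered as m_1 = d - a, m_2 = d - b, m_0 = a + b
     - d. *)
  case/eqP: ne_m; apply/mnmP.
  have := r_homog m m_r; have := r_homog m0 m0_r; rewrite /= !mdegE !big_ord3 /=.
  move: eq_a eq_b; rewrite /a /b => ? ? ? ?; apply: forall_ord3; lia.
by rewrite H_eq0 !coef0 => /esym/eqP; rewrite mcoeff_eq0 m0_r.
Qed.

End DenseRationalOrbit.

(** * Specialization of generic matrices *)

Section GenericMatrix.
Variables (K : numFieldType) (A : 'M[K]_3).
Hypothesis A_indep : alg_independent (fun k => mxvec A ord0 k).

Notation ev p v := (p.@[fun i => v i ord0]).

Definition generic_mx : 'M[{mpoly rat[3 * 3]}]_3 := vec_mx (\row_k 'X_k).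

Lemma mmap_generic_mx (S : comNzRingType) (f : {rmorphism rat -> S}) (B : 'M[S]_3) :
  map_mx (mmap f (fun k => mxvec B ord0 k)) generic_mx = B.
Proof.
apply/matrixP => i j; rewrite -[in RHS](mxvecK B) !mxE.
by rewrite mmapX mmap1U.
Qed.

(** A polynomial vanishing at the independent entries of [A] is zero, so it vanishes at every [B];
    one rational example thus decides the generic case. *)
Lemma specialization_neq0 (P : {mpoly rat[3 * 3]}) (B : 'M[rat]_3) :
  mmap idfun (fun k => mxvec B ord0 k) P != 0 ->
  mmap ratr (fun k => mxvec A ord0 k) P != 0.
Proof.
apply: contraNneq => /A_indep ->; exact/eqP/mmap0.
Qed.

Lemma orbit_generic_neq0 n : orbit A n != 0.
Proof.
have [c c_neq0 orb_n] := orbit_A0 n.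
(* One coordinate suffices: for [A0] the first is a nonzero multiple of x (N - 1), with x = n + 1
   and N = 2^(n+1). *)
have : mmap ratr (fun k => mxvec A ord0 k) (orbit generic_mx n ord0 ord0) != 0.
  apply: (@specialization_neq0 _ A0).
  have -> : mmap idfun (fun k => mxvec A0 ord0 k) (orbit generic_mx n ord0 ord0) =
      orbit A0 n ord0 ord0.
    by rewrite -[in RHS](mmap_generic_mx idfun A0) -map_orbit mxE.
  rewrite orb_n !mxE /= !mulf_neq0 ?pnatr_eq0 // subr_eq0.
  by rewrite gt_eqF // exprn_egt1.
apply: contraNneq => orb0; apply/eqP; transitivity (orbit A n ord0 ord0).
  by rewrite -[in RHS](mmap_generic_mx ratr A) -map_orbit mxE.
by rewrite orb0 mxE.
Qed.

(** Only monomials in the support of [h] are used. Orbit indices giving an invertible evaluation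
    matrix for [A0] also do so for [A], as the determinant is a rational polynomial in the
    entries. *)
Lemma dense_generic_orbit d (h : {mpoly K[3]}) : h \is d.-homog ->
  (forall n, ev h (orbit A n) = 0) -> h = 0.
Proof.
move=> /dhomogP h_homog h_orbit; pose s := msupp h; pose k := size s.
pose mon (S : comNzRingType) (v : 'cV[S]_3) : 'rV[S]_k :=
  \row_j mmap1 (fun i => v i ord0) (nth 0%MM s j).
have [f f_unit] : exists f : 'I_k -> nat, \matrix_i mon _ (orbit A0 (f i)) \in unitmx.
  apply: (@interpolation_nodes rat k (fun n => mon _ (orbit A0 n))) => c c_orbit.
  (* A column killed by all evaluation rows is the coefficient vector of a form vanishing on the
     orbit of [A0]. *)
  pose q : {mpoly rat[3]} := \sum_(j < k) c j ord0 *: 'X_[nth 0%MM s j].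
  have q_eq0 : q = 0.
    apply: (@dense_orbit_A0 d).
      apply: rpred_sum => j _; rewrite rpredZ // dhomogX; apply/eqP.
      by apply: h_homog; rewrite mem_nth.
    move=> n; have /matrixP/(_ ord0 ord0) := c_orbit n; rewrite !mxE => <-.
    rewrite /q raddf_sum; apply: eq_bigr => j _ /=.
    by rewrite mevalZ mevalX !mxE mulrC.
  apply/colP => j; have := congr1 (mcoeff (nth 0%MM s j)) q_eq0.
  rewrite mcoeff0 mxE /q raddf_sum (bigD1 j) //= mcoeffZ mcoeffX eqxx mulr1.
  rewrite big1 ?addr0 // => i /negbTE ne_ij.
  by rewrite mcoeffZ mcoeffX nth_uniq ?msupp_uniq // (inj_eq val_inj) ne_ij mulr0.
have map_mon (S : comNzRingType) (g : {rmorphism rat -> S}) B n :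
    map_mx (mmap g (fun k => mxvec B ord0 k)) (mon _ (orbit generic_mx n)) =
    mon _ (orbit B n).
  rewrite -[in RHS](mmap_generic_mx g B) -map_orbit; apply/rowP => j.
  by rewrite !mxE rmorph_prod; apply: eq_bigr => i _; rewrite rmorphXn mxE.
have map_mons (S : comNzRingType) (g : {rmorphism rat -> S}) B :
    mmap g (fun k => mxvec B ord0 k) (\det (\matrix_i mon _ (orbit generic_mx (f i)))) =
    \det (\matrix_i mon _ (orbit B (f i))).
  rewrite -det_map_mx; congr (\det _); apply/row_matrixP => i.
  by rewrite -map_row !rowK map_mon.
have : \det (\matrix_i mon _ (orbit A (f i))) != 0.
  rewrite -(map_mons _ ratr A); apply: (@specialization_neq0 _ A0).
  rewrite (map_mons _ idfun A0).
  by rewrite -unitfE -unitmxE.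
rewrite -unitfE -unitmxE => W_unit.
(* The invertible matrix sends the coefficients of [h] to its values at orbit points, all zero. *)
pose c : 'cV[K]_k := \col_j h@_(nth 0%MM s j).
have c_eq0 : c = 0.
  rewrite -[c](mulKmx W_unit); set Mc := _ *m c.
  suff -> : Mc = 0 by rewrite mulmx0.
  apply/colP => i; rewrite [RHS]mxE; apply: etrans (h_orbit (f i)).
  rewrite mxE mevalE (big_nth 0%MM) big_mkord.
  by apply: eq_bigr => j _; rewrite !mxE mulrC.
apply/eqP; rewrite -msupp_eq0 -size_eq0; apply: contraT; rewrite -lt0n => k_gt0.
have /colP/(_ (Ordinal k_gt0)) := c_eq0; rewrite !mxE => /eqP.
by rewrite mcoeff_eq0 mem_nth.
Qed.

End GenericMatrix.

Theorem mainTheorem10 (R : realType) (A : 'M[R[i]]_3) (hA : A \in unitmx)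
    (indepA : alg_independent_coeffs A) :
  zariski_dense (Ind_minus (rat_comp (linear_map A) cremona)).
Proof.
have [c c_neq0 cA_indep] := indepA.
have orbit_neq0 n : orbit A n != 0.
  have [k cA] := orbit_scale A c n; have := orbit_generic_neq0 cA_indep n.
  by apply: contraNneq => orb0; rewrite cA orb0 scaler0.
apply/seteqP; split=> // x _ _ [[S S_homog ->]] Ind_S p Sp.
have [d p_homog] := S_homog p Sp.
(* The equations of a closed set containing [Ind_minus] are all zero, so that set contains every
   point [x]. *)
suff -> : p = 0 by move=> v _; rewrite meval0.
apply: (dense_generic_orbit cA_indep p_homog) => n.
have [k ->] := orbit_scale A c n; rewrite (evZ _ _ p_homog).
have /(_ p Sp) := Ind_S _ (orbit_Ind_minus (orbit_neq0 n) hA).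
by move/(vanishes_at_point _ p_homog) ->; rewrite mulr0.
Qed.
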